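(* Let $q$ be a prime power, $\delta\in\mathbb{F}_{q^2}$ with $\delta^{q+1}=1$, $s(x)=x^q+\delta x$, and $m>1$ an integer. Let $W$ denote the $\mathbb{F}_q$-linear span of the image of the map $x\mapsto s(x)^m$ on $\mathbb{F}_{q^2}$. If $x^m+\gamma x$ is a permutation polynomial of $\mathbb{F}_q$ for some $\gamma\in\mathbb{F}_q^*$, then there exists a linearized polynomial $L(x)$ over $\mathbb{F}_{q^2}$ of rank $2$ with $L(\ker s)\not\subseteq W$ such that $s(x)^m+L(x)$ is a (normalized) permutation polynomial of $\mathbb{F}_{q^2}$. Moreover, if there are $k$ distinct $\gamma\in\mathbb{F}_q^*$ such that $x^m+\gamma x$ is a permutation polynomial of $\mathbb{F}_q$, then there are $kq^2(q-1)$ distinct rank-$2$ linearized polynomials $L(x)$ with $L(\ker s)\not\subseteq W$ such that $s(x)^m+L(x)$ is a permutation polynomial of $\mathbb{F}_{q^2}$.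
   Context: A linearized polynomial over $\mathbb{F}_{q^2}$ is $L(x)=\alpha_1x^q+\alpha_0x$ with $\alpha_0,\alpha_1\in\mathbb{F}_{q^2}$; its rank, kernel and image are those of the $\mathbb{F}_q$-linear evaluation map on the $2$-dimensional $\mathbb{F}_q$-space $\mathbb{F}_{q^2}$. A permutation polynomial of a finite field is one whose evaluation map is a bijection of that field; ''normalized'' means monic and mapping $0$ to $0$. *)

(* Defs.v *)
From HB Require Import structures.
From mathcomp Require Import all_boot all_order all_algebra.
From mathcomp Require Import all_fingroup all_solvable all_field.

Set Implicit Arguments.
Unset Strict Implicit.
Unset Printing Implicit Defensive.

Import GRing.Theory.
Local Open Scope ring_scope.

Definition perm_poly (R : nzRingType) (p : {poly R}) : Prop :=
  bijective (fun x : R => p.[x]).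

Definition normalized (R : nzRingType) (p : {poly R}) : Prop :=
  p \is monic /\ p.[0] = 0.

Definition has_exactly (T : eqType) (n : nat) (P : T -> Prop) : Prop :=
  exists xs : seq T, [/\ uniq xs, size xs = n & forall x, x \in xs <-> P x].

Section Linearized.

Variables (F : finFieldType) (K : fieldExtType F).

(* Since \dim {:K} = 2 in the application, two coefficients suffice: 'X^(q^2)
   evaluates as 'X on K. *)
Definition linearized (q : nat) (L : {poly K}) : Prop :=
  exists a1 a0 : K, L = a1 *: 'X^q + a0 *: 'X.

(* [linfun] agrees with its argument only when the latter is F-linear; for
   linearized L this is [lin_evalE] below. *)
Definition lin_eval (L : {poly K}) : 'End(K) := linfun (fun x : K => L.[x]).

Definition lin_rank (L : {poly K}) : nat := \dim (limg (lin_eval L)).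

(* [finvect_type K] is K itself, seen as a finite type so that its elements can
   be enumerated. *)
Definition span_image (f : K -> K) : {vspace K} :=
  <<[seq f x | x : finvect_type K]>>%VS.

Lemma span_image_mem (f : K -> K) (x : K) : f x \in span_image f.
Proof.
by apply: memv_span; apply/mapP; exists (x : finvect_type K); rewrite ?mem_enum.
Qed.

Lemma span_image_sub (f : K -> K) (U : {vspace K}) :
  (forall x, f x \in U) -> (span_image f <= U)%VS.
Proof. by move=> fU; apply/span_subvP => _ /mapP[x _ ->]. Qed.

Lemma pchar_nat_card : [pchar K].-nat #|F|.
Proof.
have [p p_pr chFp] := finPcharP F.
have -> : #|F| = #|pPrimeCharType chFp| by [].
rewrite (card_pprimeChar chFp) pnatX orbC /= pnatE //.
by rewrite (rmorph_pchar (in_alg K)) // orbT.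
Qed.

Lemma lin_evalE (L : {poly K}) : linearized #|F| L -> lin_eval L =1 horner L.
Proof.
case=> a1 [a0 DL].
have linL : linear (fun x : K => L.[x]).
  move=> c x y; rewrite DL !hornerE.
  rewrite (exprDn_pchar _ _ pchar_nat_card) exprZn expf_card.
  by rewrite !mulrDr -!scalerAr scalerDr addrACA !addrA.
pose lL := GRing.isLinear.Build F K K *:%R (fun x : K => L.[x]) linL.
pose fL : {linear K -> K} := HB.pack (fun x : K => L.[x]) lL.
by move=> x; rewrite (lfunE fL).
Qed.

End Linearized.

(* Main.v *)
(* Let u span ker s and pick v with c := s(v) <> 0. Then s maps K onto F c, so
   W = F w with w = c^m, and (u, v) is an F-basis of K. A linearized L is
   determined by L(u) and L(v), which may be prescribed freely. If L(u) is not
   in W, write L(v) = A L(u) + B w; then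
     (s^m + L)(a u + t v) = (a + t A) L(u) + (t^m + B t) w,
   so s^m + L permutes K iff t^m + B t permutes F, and L has rank 2 iff B <> 0.
   There are q^2 - q choices of L(u), q choices of A and k choices of B. *)
Require Import Defs.
From mathcomp Require Import all_boot all_order all_algebra.
From mathcomp Require Import all_fingroup all_solvable all_field ring.

Set Implicit Arguments.
Unset Strict Implicit.
Unset Printing Implicit Defensive.

Import GRing.Theory.
Local Open Scope ring_scope.

(** * Counting and finiteness tools *)

Lemma has_exactly_image (S T : eqType) (n : nat) (f : S -> T) (xs : seq S)
    (P : T -> Prop) :
  uniq xs -> size xs = n -> {in xs &, injective f} ->
  (forall y, P y <-> exists2 x, x \in xs & y = f x) -> has_exactly n P.
Proof.
move=> Uxs sz_xs f_inj Pf; exists (map f xs); split.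
- by rewrite map_inj_in_uniq.
- by rewrite size_map.
- by move=> y; split=> [/mapP | /Pf ?]; [move/Pf | apply/mapP].
Qed.

(** The type [V] carries no finite structure of its own, so the pigeonhole argument runs on its
    finite copy [finvect_type V]. *)
Lemma finvect_inj_bij (F : finFieldType) (V : vectType F) (f : V -> V) :
  injective f -> bijective f.
Proof. exact: (@injF_bij (finvect_type V)). Qed.

(** * Linearized polynomials over the quadratic extension *)

Section QuadraticExtension.

Variables (F : finFieldType) (K : fieldExtType F).
Hypothesis hK : \dim {:K} = 2%N.
Local Notation q := #|F|.
Implicit Types (x y u v w : K) (a b t : F) (L : {poly K}).

Lemma expf_cardK x : (x ^+ q) ^+ q = x.
Proof.
apply/eqP; rewrite -exprM mulnn -hK.
by rewrite -(Fermat's_little_theorem {:K}%AS) memvf.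
Qed.

Lemma card_finvect : #|finvect_type K| = (q ^ 2)%N.
Proof.
rewrite -hK -(card_vspace (fullv : {vspace finvect_type K})).
by apply: eq_card => x; rewrite memvf.
Qed.

(** The degree is at most q, while K has q^2 > q elements, so a nonzero [L] has too few roots to
    vanish on all of K. *)
Lemma linearized_nonroot L :
  linearized q L -> L != 0 -> exists y, L.[y] != 0.
Proof.
case=> a1 [a0 DL] nzL; have q_gt1 : (1 < q)%N := finNzRing_gt1 F.
have [y|allL] := pickP (fun y : finvect_type K => L.[y] != 0).
  by exists y.
have rootL : all (root L) (enum (finvect_type K)).
  by apply/allP=> y _; have /negbFE := allL y.
have : (size (enum (finvect_type K)) < size L)%N.
  exact: max_poly_roots nzL rootL (enum_uniq _).
rewrite -cardE card_finvect.
suff szL : (size L <= q.+1)%N.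
  move=> /leq_trans/(_ szL); rewrite ltnS leqNgt.
  by rewrite -{1}[q]expn1 ltn_exp2l // q_gt1.
rewrite DL (leq_trans (size_polyD _ _)) // geq_max.
rewrite !(leq_trans (size_scale_leq _ _)) ?size_polyXn ?size_polyX //.
exact: ltnW.
Qed.

Lemma linearizedP L a t u v :
  linearized q L -> L.[a *: u + t *: v] = a *: L.[u] + t *: L.[v].
Proof. by move=> linL; rewrite -!(lin_evalE linL) linearD !linearZ. Qed.

Lemma linearizedB L1 L2 :
  linearized q L1 -> linearized q L2 -> linearized q (L1 - L2).
Proof.
case=> a1 [a0 ->] [b1 [b0 ->]]; exists (a1 - b1), (a0 - b0).
by rewrite !scalerBl opprD addrACA.
Qed.

Lemma linearized_inj L1 L2 :
  linearized q L1 -> linearized q L2 -> horner L1 =1 horner L2 -> L1 = L2.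
Proof.
move=> lin1 lin2 eqL; apply/eqP; rewrite -subr_eq0; apply/negPn/negP.
case/(linearized_nonroot (linearizedB lin1 lin2))=> y.
by rewrite !hornerE eqL subrr eqxx.
Qed.

Lemma lin_rank2P L :
  linearized q L -> lin_rank L = 2%N <-> injective (horner L).
Proof.
move=> linL; have eqL := lin_evalE linL.
have dimL := limg_ker_dim (lin_eval L) {:K}; rewrite capfv hK in dimL.
rewrite /lin_rank; split=> [rkL | injL].
  have /lker0P injL : lker (lin_eval L) == 0%VS.
    by rewrite -dimv_eq0 -(eqn_add2r 2) -{1}rkL dimL.
  exact: eq_inj injL eqL.
have /lker0P/eqP ker0 := eq_inj injL (fsym eqL).
by rewrite ker0 dimv0 in dimL.
Qed.

Lemma linearized_Xq : linearized q ('X^q : {poly K}).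
Proof. by exists 1, 0; rewrite scale1r scale0r addr0. Qed.

(** * The polynomial s, its degree and its kernel *)

Variable delta : K.
Hypothesis hdelta : delta ^+ q.+1 = 1.
Local Notation s := ('X^q + delta *: 'X).

Lemma linearized_s : linearized q s.
Proof. by exists 1, delta; rewrite scale1r. Qed.

Lemma size_s : size (s : {poly K}) = q.+1.
Proof.
rewrite size_polyDl size_polyXn // (leq_ltn_trans (size_scale_leq _ _)) //.
by rewrite size_polyX ltnS (finNzRing_gt1 F).
Qed.

Lemma monic_s : s \is monic.
Proof.
rewrite monicE lead_coefDl ?lead_coefXn // size_polyXn.
rewrite (leq_ltn_trans (size_scale_leq _ _)) //.
by rewrite size_polyX ltnS (finNzRing_gt1 F).
Qed.

Lemma horner_s x : s.[x] = x ^+ q + delta * x.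
Proof. by rewrite !hornerE. Qed.

(** As m > 1, the degree qm of [s ^+ m] exceeds q, which bounds the degree of [L]; the leading
    coefficient is thus that of the monic [s ^+ m]. *)
Lemma normalized_sXmD m L :
  (1 < m)%N -> linearized q L -> normalized (s ^+ m + L).
Proof.
move=> m_gt1 [a1 [a0 DL]]; have q_gt0 : (0 < q)%N := ltnW (finNzRing_gt1 F).
split; last first.
  rewrite DL !hornerE !expr0n (gtn_eqF q_gt0) /= expr0n (gtn_eqF (ltnW m_gt1)).
  by rewrite mulr0 !addr0.
have szL : (size L <= q.+1)%N.
  rewrite DL (leq_trans (size_polyD _ _)) // geq_max.
  by rewrite !(leq_trans (size_scale_leq _ _)) ?size_polyXn ?size_polyX.
rewrite monicE lead_coefDl; first by rewrite -monicE monic_exp // monic_s.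
rewrite (leq_ltn_trans szL) //.
have -> : size (s ^+ m) = (q * m).+1.
  rewrite -(prednK (_ : 0 < size (s ^+ m))%N) ?size_exp ?size_s //.
  by rewrite size_poly_gt0 monic_neq0 // monic_exp // monic_s.
by rewrite ltnS -{1}[q]muln1 ltn_mul2l q_gt0.
Qed.

Lemma delta_neq0 : delta != 0.
Proof.
apply/eqP=> d0; have /eqP := hdelta.
by rewrite d0 exprS mul0r eq_sym oner_eq0.
Qed.

(** Any u = y - y^q / delta lies in ker s: since delta^q = 1 / delta and y^(q^2) = y, one gets u^q =
    y^q - delta y = - delta u. Both this expression in y and s are nonzero linearized polynomials,
    so neither vanishes identically. *)
Lemma ker_basis : exists u v, [/\ u != 0, s.[u] = 0 & s.[v] != 0].
Proof.
have q_gt1 : (1 < q)%N := finNzRing_gt1 F.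
have dq : delta ^+ q = delta^-1.
  by apply: (mulfI delta_neq0); rewrite -exprS hdelta divff ?delta_neq0.
have [y nz_u] : exists y, ((- delta^-1) *: 'X^q + 1 *: 'X : {poly K}).[y] != 0.
  apply: linearized_nonroot; first by exists (- delta^-1), 1.
  (* Since q > 1, the coefficient of degree 1 is exactly 1. *)
  apply/eqP=> /(congr1 (fun p : {poly K} => p`_1)).
  rewrite !coefE (ltn_eqF q_gt1) mulr0 add0r mulr1.
  by apply/eqP; rewrite oner_eq0.
have [v nz_v] : exists v, s.[v] != 0.
  apply: linearized_nonroot; first exact: linearized_s.
  exact: monic_neq0 monic_s.
set u := _.[y] in nz_u; exists u, v; split=> //.
have Du : u = (- delta^-1) * y ^+ q + y by rewrite /u !hornerE.
have uq : u ^+ q = (- delta^-1) ^+ q * y + y ^+ q.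
  by rewrite Du (exprDn_pchar _ _ (pchar_nat_card K)) exprMn expf_cardK.
have Nq : (- delta^-1) ^+ q = - delta.
  (* Linearity of the q-th power takes the sign out whatever the parity of q. *)
  have := linearizedP (-1) 0 delta^-1 0 linearized_Xq.
  by rewrite !scale0r !addr0 !hornerE !scaleN1r exprVn dq invrK.
by rewrite horner_s uq Nq Du; field; exact: delta_neq0.
Qed.

(** * Bases of K and interpolation on them *)

Lemma comb_inj y w a t a' t' : w != 0 -> y \notin <[w]>%VS ->
  a *: y + t *: w = a' *: y + t' *: w -> a = a' /\ t = t'.
Proof.
move=> nz_w yNw /eqP.
rewrite -subr_eq0 opprD addrACA -!scalerBl addr_eq0 -scaleNr => /eqP eq_aw.
have aa' : a = a'.
  apply/eqP; rewrite -subr_eq0; apply: contraNT yNw => nz_a.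
  by rewrite -[y](scalerK nz_a) eq_aw !memvZ ?memv_line.
split=> //; move/esym/eqP: eq_aw; rewrite aa' subrr scale0r scaler_eq0.
by rewrite (negPf nz_w) orbF oppr_eq0 subr_eq0 => /eqP.
Qed.

Lemma comb_surj y w x : w != 0 -> y \notin <[w]>%VS ->
  exists a t, x = a *: y + t *: w.
Proof.
move=> nz_w yNw.
have full : (<[y]> + <[w]>)%VS = fullv.
  have dim_w : \dim <[w]> = 1%N by rewrite dim_vline nz_w.
  (* The goal that the sum has dimension at least 2 becomes a strict inequality over the dimension 1
     of the line of [w], which holds because [y] is off that line. *)
  apply/eqP; rewrite eqEdim subvf hK -dim_w.
  rewrite (ltn_leqif (dimv_leqif_sup (addvSr <[y]> <[w]>))).
  by apply: contra yNw => /subvP; apply; rewrite (subvP (addvSl _ _)) ?memv_line.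
have /memv_addP[_ /vlineP[a ->] [_ /vlineP[t ->] ->]] : x \in (<[y]> + <[w]>)%VS.
  by rewrite full memvf.
by exists a, t.
Qed.
(** Cramer's rule for the system a1 u^q + a0 u = y, a1 v^q + a0 v = z, of determinant [D]. *)
Definition interp u v y z : {poly K} :=
  let D := u ^+ q * v - v ^+ q * u in
  ((y * v - z * u) / D) *: 'X^q + ((u ^+ q * z - v ^+ q * y) / D) *: 'X.

Lemma linearized_interp u v y z : linearized q (interp u v y z).
Proof. by rewrite /interp; eexists; eexists. Qed.

(** * Reduction to the values at u and v *)

Section KernelBasis.

Variables u v : K.
Hypotheses (nz_u : u != 0) (su0 : s.[u] = 0) (nz_sv : s.[v] != 0).

Lemma horner_s_comb t a : s.[t *: v + a *: u] = t *: s.[v].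
Proof. by rewrite linearizedP ?su0 ?scaler0 ?addr0 //; apply: linearized_s. Qed.

Lemma ker_compl : v \notin <[u]>%VS.
Proof.
apply: contra nz_sv => /vlineP[a ->].
by have := horner_s_comb 0 a; rewrite !scale0r add0r => ->.
Qed.

Lemma interpP y z : (interp u v y z).[u] = y /\ (interp u v y z).[v] = z.
Proof.
have nzD : u ^+ q * v - v ^+ q * u != 0.
  (* Substituting u^q = - delta u turns the determinant into - u s(v). *)
  have /eqP := su0; rewrite horner_s addr_eq0 => /eqP ->.
  have -> : - (delta * u) * v - v ^+ q * u = - (u * s.[v]).
    by rewrite horner_s; ring.
  by rewrite oppr_eq0 mulf_neq0.
by split; rewrite /interp !hornerE; field.
Qed.

Lemma linearized_ext L1 L2 : linearized q L1 -> linearized q L2 ->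
  L1.[u] = L2.[u] -> L1.[v] = L2.[v] -> L1 = L2.
Proof.
move=> lin1 lin2 equ eqv; apply: linearized_inj => // x.
have [t [a ->]] := comb_surj x nz_u ker_compl.
by rewrite !linearizedP // equ eqv.
Qed.

Variable m : nat.
Local Notation w := (s.[v] ^+ m).

(** At t v + a u the map takes the value t^m w with t^m in F, and at v it takes the value w. *)
Lemma span_sX : span_image (fun x => s.[x] ^+ m) = <[w]>%VS.
Proof.
apply: subv_anti; rewrite -memvE (span_image_mem (fun x => s.[x] ^+ m)) andbT.
apply: span_image_sub => x; have [t [a ->]] := comb_surj x nz_u ker_compl.
by rewrite horner_s_comb exprZn memvZ ?memv_line.
Qed.

(** The kernel of s is the line of u, so its image under [L] is spanned by L(u). *)
Lemma img_ker_sP L : linearized q L ->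
  ~ (lin_eval L @: lker (lin_eval s) <= <[w]>)%VS <-> L.[u] \notin <[w]>%VS.
Proof.
move=> linL; split=> [LkerNw | /negP LuNw /subvP Lker_w]; last first.
  apply/LuNw/Lker_w; rewrite -(lin_evalE linL) memv_img //.
  by rewrite memv_ker (lin_evalE linearized_s) su0.
apply/negP => Lu_w; apply: LkerNw; apply/subvP=> _ /memv_imgP[x + ->].
have [t [a ->]] := comb_surj x nz_u ker_compl.
rewrite memv_ker (lin_evalE linearized_s) horner_s_comb scaler_eq0 (negPf nz_sv).
rewrite orbF => /eqP ->.
by rewrite (lin_evalE linL) linearizedP // scale0r add0r memvZ.
Qed.

(** * Rank and bijectivity in coordinates *)

Section Coordinates.

Variables (L : {poly K}) (A B : F).
Hypotheses (linL : linearized q L) (LuNw : L.[u] \notin <[w]>%VS).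
Hypothesis Lv : L.[v] = A *: L.[u] + B *: w.

Let nz_w : w != 0. Proof. exact: expf_neq0. Qed.

Lemma horner_comb t a :
  L.[t *: v + a *: u] = (t * A + a) *: L.[u] + (B * t) *: w.
Proof.
rewrite linearizedP // Lv scalerDr addrAC !scalerA -scalerDl.
by rewrite [t * B]mulrC.
Qed.

Lemma horner_sXmD_comb t a :
  (s ^+ m + L).[t *: v + a *: u]
    = (t * A + a) *: L.[u] + ('X^m + B *: 'X).[t] *: w.
Proof.
have -> : ('X^m + B *: 'X).[t] = t ^+ m + B * t by rewrite !hornerE.
rewrite hornerD horner_exp horner_s_comb exprZn horner_comb.
by rewrite addrCA -scalerDl.
Qed.

(** In the bases (v, u) and (L(u), w), [L] is the triangular map (t, a) -> (t A + a, B t). If B = 0,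
    then L(v) = L(A u) although v is not on the line of u. *)
Lemma lin_rank2_coord : lin_rank L = 2%N <-> B != 0.
Proof.
rewrite lin_rank2P //; split=> [injL | nzB].
  apply: contra ker_compl => /eqP B0; apply/vlineP; exists A; apply: injL.
  rewrite Lv B0 scale0r addr0 -[A *: u in RHS]add0r -[0 in RHS](scale0r v).
  by rewrite linearizedP // scale0r add0r.
move=> x x'.
have [t [a ->]] := comb_surj x nz_u ker_compl.
have [t' [a' ->]] := comb_surj x' nz_u ker_compl.
rewrite !horner_comb => /(comb_inj nz_w LuNw)[eqa /(mulfI nzB) eqt].
by move: eqa; rewrite eqt => /addrI ->.
Qed.

(** The map is again triangular, (t, a) -> (t A + a, t^m + B t), and on finite sets injectivity
    suffices. *)
Lemma perm_poly_coord : perm_poly (s ^+ m + L) <-> perm_poly ('X^m + B *: 'X).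
Proof.
split=> [/bij_inj inj_f | /bij_inj inj_g].
  apply: injF_bij => t t' eq_g.
  (* Taking a = - t A kills the L(u)-coordinate, so a collision of t^m + B t in F lifts to one in
     K. *)
  have := inj_f (t *: v + (- (t * A)) *: u) (t' *: v + (- (t' * A)) *: u).
  rewrite !horner_sXmD_comb eq_g !subrr.
  by move=> /(_ erefl) /(comb_inj nz_u ker_compl)[].
apply: finvect_inj_bij => x x'.
have [t [a ->]] := comb_surj x nz_u ker_compl.
have [t' [a' ->]] := comb_surj x' nz_u ker_compl.
rewrite !horner_sXmD_comb => /(comb_inj nz_w LuNw)[eqa /inj_g eqt].
by move: eqa; rewrite eqt => /addrI ->.
Qed.

End Coordinates.

(** * Parametrization and count of the admissible L *)

Lemma sXmD_permP L :
  [/\ linearized q L, lin_rank L = 2%N,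
      ~ (lin_eval L @: lker (lin_eval s) <= <[w]>)%VS & perm_poly (s ^+ m + L)]
  <-> exists y, exists A, exists B, [/\ y \notin <[w]>%VS,
        B != 0 /\ perm_poly ('X^m + B *: 'X)
      & L = interp u v y (A *: y + B *: w)].
Proof.
split=> [[linL rkL /(img_ker_sP linL) LuNw permL]
        | [y [A [B [yNw [nzB permB] ->]]]]].
  have nz_w : w != 0 by exact: expf_neq0.
  have [A [B Lv]] := comb_surj L.[v] nz_w LuNw.
  exists L.[u], A, B; split=> //.
    split; first exact/(lin_rank2_coord linL LuNw Lv).
    exact/(perm_poly_coord linL LuNw Lv).
  have [Iu Iv] := interpP L.[u] (A *: L.[u] + B *: w).
  by apply: linearized_ext; rewrite ?Iu ?Iv //; apply: linearized_interp.
have [] := interpP y (A *: y + B *: w).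
have := linearized_interp u v y (A *: y + B *: w).
set I := interp _ _ _ _ => linL Lu Lv; rewrite -Lu in yNw Lv.
split=> //; first exact/(lin_rank2_coord linL yNw Lv).
  exact/img_ker_sP.
exact/(perm_poly_coord linL yNw Lv).
Qed.

Lemma card_not_line :
  #|[pred y : finvect_type K | y \notin <[w]>%VS]| = (q * (q - 1))%N.
Proof.
have nz_w : w != 0 by exact: expf_neq0.
have := cardC [pred y : finvect_type K | y \in <[w]>%VS].
rewrite card_finvect (card_vspace (<[w : finvect_type K]>%VS)).
rewrite dim_vline nz_w expn1 mulnBr muln1 mulnn => <-.
by rewrite addKn.
Qed.

Lemma count_sXmD_perm k :
  has_exactly k (fun B : F => B != 0 /\ perm_poly ('X^m + B *: 'X)) ->
  has_exactly (k * q ^ 2 * (q - 1))%N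
    (fun L => [/\ linearized q L, lin_rank L = 2%N,
      ~ (lin_eval L @: lker (lin_eval s) <= <[w]>)%VS & perm_poly (s ^+ m + L)]).
Proof.
have nz_w : w != 0 by exact: expf_neq0.
case=> Bs [UBs szBs BsP].
pose Ys : seq K := enum [pred y : finvect_type K | y \notin <[w]>%VS].
(* The parameters are triples (L(u), A, B), with q (q - 1), q and k choices respectively. *)
pose ps := [seq (yA, B) | yA <- [seq (y, A) | y <- Ys, A <- enum F], B <- Bs].
pose f (p : K * F * F) := interp u v p.1.1 (p.1.2 *: p.1.1 + p.2 *: w).
have UYs : uniq Ys by exact: enum_uniq.
have szYs : size Ys = (q * (q - 1))%N by rewrite -card_not_line cardE.
have YsP y : (y \in Ys) = (y \notin <[w]>%VS).
  exact: (mem_enum [pred y : finvect_type K | y \notin <[w]>%VS]).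
have psP p : reflect (p.1.1 \notin <[w]>%VS /\ p.2 \in Bs) (p \in ps).
  apply: (iffP allpairsP) => [[[yA B] [/= + Bs_B ->]] | [yNw Bs_p]].
    by case/allpairsP=> -[y A] [/= + _ ->]; rewrite YsP.
  exists p; split=> //; last by case: p {yNw Bs_p}.
  apply/allpairsP; exists p.1.
  by rewrite YsP mem_enum; split=> //; case: p.1.
apply: (@has_exactly_image _ _ _ f ps).
- by rewrite !allpairs_uniq ?UYs ?enum_uniq // => -[? ?] [? ?].
- rewrite !size_allpairs szYs -cardE szBs; ring.
(* The value at u returns y; the value at v then returns A and B, as y and w are independent. *)
- move=> [[y A] B] [[y' A'] B'] /psP[/= yNw _] /psP[/= yNw' _] eqf.
  have [Iu Iv] := interpP y (A *: y + B *: w).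
  have [Iu' Iv'] := interpP y' (A' *: y' + B' *: w).
  have eqy : y = y' by rewrite -Iu -Iu' -/(f (y, A, B)) eqf.
  subst y'.
  suff /(comb_inj nz_w yNw)[-> ->] : A *: y + B *: w = A' *: y + B' *: w by [].
  by rewrite -Iv -Iv' -/(f (y, A, B)) eqf.
move=> L; split=> [/sXmD_permP[y [A [B [yNw /BsP BsB ->]]]]
                  | [p /psP[yNw /BsP Bp] ->]].
  by exists (y, A, B) => //; apply/psP.
by apply/sXmD_permP; exists p.1.1, p.1.2, p.2.
Qed.

End KernelBasis.

End QuadraticExtension.

Theorem theorem3 (q : nat) (F : finFieldType) (hF : #|F| = q)
    (K : fieldExtType F) (hK : \dim {:K} = 2%N)
    (delta : K) (hdelta : delta ^+ q.+1 = 1) (m : nat) (hm : (1 < m)%N) :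
  let s : {poly K} := 'X^q + delta *: 'X in
  let W : {vspace K} := span_image (fun x : K => s.[x] ^+ m) in
  ((exists gamma : F, gamma != 0 /\ perm_poly ('X^m + gamma *: 'X)) ->
   exists L : {poly K},
     [/\ linearized q L, lin_rank L = 2%N,
         ~ (lin_eval L @: lker (lin_eval s) <= W)%VS,
         perm_poly (s ^+ m + L)
       & normalized (s ^+ m + L)])
  /\
  (forall k : nat,
   has_exactly k
     (fun gamma : F => gamma != 0 /\ perm_poly ('X^m + gamma *: 'X)) ->
   has_exactly (k * q ^ 2 * (q - 1))%N
     (fun L : {poly K} =>
       [/\ linearized q L, lin_rank L = 2%N,
           ~ (lin_eval L @: lker (lin_eval s) <= W)%VS
         & perm_poly (s ^+ m + L)])).
Proof.
subst q; move=> s W.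
have [u [v [nz_u su0 nz_sv]]] := ker_basis hK hdelta.
have DW : W = <[s.[v] ^+ m]>%VS := span_sX hK nz_u su0 nz_sv m.
rewrite DW; split=> [[B permB] | k]; last first.
  exact: (count_sXmD_perm hK nz_u su0 nz_sv).
have [y yNw] : exists y, y \notin <[s.[v] ^+ m]>%VS.
  have q_gt1 := finNzRing_gt1 F.
  have := card_not_line hK nz_sv m; set A := [pred y | _] => cardA.
  have /card_gt0P[y yNw] : (0 < #|A|)%N.
    by rewrite cardA muln_gt0 subn_gt0 q_gt1 ltnW.
  by exists y.
(* Every A is admissible; A = 0 is the simplest choice. *)
pose L := interp u v y (0 *: y + B *: s.[v] ^+ m).
have [] := (sXmD_permP hK nz_u su0 nz_sv m L).2; first by exists y, 0, B.
by move=> linL rkL LkerNw permL; exists L; split=> //; apply: normalized_sXmD.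
Qed.
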